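(* For every $\gamma\in[0,1)$ there exists $\tau_\gamma\in[1/2,1]$ such that classifiers $Y^*_\gamma$ with the following properties exist: $\mathbf P(Y^*_\gamma=0)=\gamma$; almost surely $\{1-\tau_\gamma<\eta(X)<\tau_\gamma\}\subset\{Y^*_\gamma=0\}\subset\{1-\tau_\gamma\le\eta(X)\le\tau_\gamma\}$; and on $\{Y^*_\gamma\neq0\}$, $Y^*_\gamma=\arg\max_{i\in\{1,2\}}p_if_i(X)$. Every such $Y^*_\gamma$ is optimal for $\mathcal R(\gamma)$, i.e. $\mathcal R(\gamma)=\mathbf P(Y^*_\gamma\ne Y\mid Y^*_\gamma\neq 0)$, and $$\mathcal R(\gamma)=\frac{\mathbf E\big[\min(\eta(X),1-\eta(X))\,\mathbf 1\{Y^*_\gamma\neq0\}\big]}{1-\gamma},$$ which, when $Y^*_\gamma$ is non-randomized with indecision set $\Theta_\gamma=\{x: Y^*_\gamma(x)=0\}$, equals $\frac{1}{1-\gamma}\int_{\Theta_\gamma^c}(p_1f_1\wedge p_2f_2)\,d\mu$.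
   Context: Setup (binary classification with indecisions). $(\mathcal X,\mathcal U)$ is a measurable space with a $\sigma$-finite measure $\mu$; $P_1\neq P_2$ are probability measures on it with densities $f_1,f_2$ with respect to $\mu$; $p_1,p_2>0$ with $p_1+p_2=1$. The pair $(X,Y)$ satisfies $\mathbf P(Y=i)=p_i$ and, given $Y=i$, $X\sim P_i$ ($i=1,2$). A classifier (with indecisions) is a measurable function $\tilde Y=\tilde Y(X,U)$ with values in $\{0,1,2\}$, where $U\sim\mathrm{Unif}[0,1]$ is independent of $(X,Y)$ (randomization is allowed); the value $0$ means indecision. Define $\eta(x)=\frac{p_1f_1(x)}{p_1f_1(x)+p_2f_2(x)}$ (so $\eta(X)=\mathbf P(Y=1\mid X)$ a.s.). For $\gamma\in[0,1)$, $\mathcal R(\gamma):=\inf_{\tilde Y}\mathbf P(\tilde Y\neq Y\mid \tilde Y\neq 0)$, the infimum over all classifiers with $\mathbf P(\tilde Y=0)=\gamma$. *)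

(* Defs.v *)
From HB Require Import structures.
From mathcomp Require Import all_boot all_order all_algebra.
From mathcomp Require Import all_classical all_reals all_analysis.
Set Implicit Arguments. Unset Strict Implicit. Unset Printing Implicit Defensive.
Import Order.TTheory GRing.Theory Num.Theory.
Local Open Scope classical_set_scope.
Local Open Scope ring_scope.

Section Classif.
Context (d : measure_display) (T : measurableType d) (R : realType)
  (mu : {measure set T -> \bar R}) (f1 f2 : T -> R) (p1 p2 : R).

(* U ~ Unif[0,1]: Lebesgue measure restricted to [0,1]. *)
Definition leb : {measure set (measurableTypeR R) -> \bar R} := lebesgue_measure.

(* p1 f1 + p2 f2 : density of X w.r.t. mu *)
Definition mixdens (x : T) : R := p1 * f1 x + p2 * f2 x.

(* eta(x) = P(Y = 1 | X = x) *)
Definition etaf (x : T) : R := p1 * f1 x / mixdens x.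

(* A classifier with indecisions: a measurable function of (X,U) with values
   in {0,1,2} (0 = indecision).  Measurability for a discrete codomain:
   each level set is measurable in the product sigma-algebra. *)
Definition classifier (C : T -> R -> nat) : Prop :=
  (forall x u, (C x u <= 2)%N) /\
  forall k : nat,
    measurable [set z : T * measurableTypeR R | C z.1 z.2 = k].

(* P((X,U,Y) in E) for the joint law: P(Y=i) = p_i, X | Y=i ~ f_i dmu,
   U ~ Unif[0,1] independent of (X,Y). *)
Definition Prob (E : T -> R -> nat -> bool) : \bar R :=
  (\int[mu]_x \int[leb]_(u in `[0%R, 1%R])
     ((p1 * f1 x * (E x u 1%N)%:R + p2 * f2 x * (E x u 2%N)%:R)%:E))%E.

Definition Expect (g : T -> R -> R) : \bar R :=
  (\int[mu]_x \int[leb]_(u in `[0%R, 1%R]) ((mixdens x * g x u)%:E))%E.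

Definition as_ (Q : T -> R -> bool) : Prop :=
  Prob (fun x u _ => ~~ Q x u) = 0%E.

Definition Pindec (C : T -> R -> nat) : \bar R :=
  Prob (fun x u _ => C x u == 0%N).

Definition cond_err (C : T -> R -> nat) : R :=
  fine (Prob (fun x u y => (C x u != y) && (C x u != 0%N)))
  / fine (Prob (fun x u _ => C x u != 0%N)).

Definition Rrisk (gamma : R) : R :=
  inf [set cond_err C | C in [set C | classifier C /\ Pindec C = gamma%:E]].

Definition is_Ystar (gamma tau : R) (C : T -> R -> nat) : Prop :=
  [/\ classifier C,
      Pindec C = gamma%:E,
      as_ (fun x u => (1 - tau < etaf x < tau) ==> (C x u == 0%N)),
      as_ (fun x u => (C x u == 0%N) ==> (1 - tau <= etaf x <= tau)) &
      as_ (fun x u => ((C x u == 1%N) ==> (p2 * f2 x <= p1 * f1 x)) &&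
                      ((C x u == 2%N) ==> (p1 * f1 x <= p2 * f2 x)))].

End Classif.

(* Main.v *)
Require Import Defs.
From HB Require Import structures.
From mathcomp Require Import all_boot all_order all_algebra.
From mathcomp Require Import all_classical all_reals all_analysis.
From mathcomp Require Import measurable_realfun ring lra.
Import Order.TTheory GRing.Theory Num.Theory.
Local Open Scope classical_set_scope.
Local Open Scope ring_scope.

(** Integrating out the randomization [U], a classifier [C] only enters through
    the conditional probabilities [level C k x] of answering [k] at [x].  Write
    [m = p1 f1 + p2 f2], [M = max (p1 f1) (p2 f2)] and [a = 1 - level C 0].
    The error probability is at least the integral of [(m - M) a], with equality
    when [C] decides by the larger [p_i f_i], while the integral of [m a] is
    fixed to [1 - gamma].  As [(m - M) - (1 - tau) m = tau m - M], a
    Neyman-Pearson argument shows that the integral of [(m - M) a] is minimal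
    when [a = 0] on [M < tau m] and [a = 1] on [M > tau m]; these are the
    conditions [1 - tau < eta < tau] and [eta] outside [[1 - tau, tau]], except
    where [m = 0].  A suitable [tau] is a [gamma]-quantile of [M / m] under the
    law of [X], with randomization on [M = tau m] to reach [gamma] exactly. *)

(** * Conditional distribution of the answer given the observation *)

Definition level {T : Type} {R : realType} (C : T -> R -> nat) (k : nat)
    (x : T) : R :=
  fine (leb R (`[0, 1] `&` [set u | C x u = k])%classic).

Lemma leb_itv0 (R : realType) (r : R) : 0 <= r ->
  leb R `[0, r]%classic = r%:E.
Proof.
move=> r0; transitivity (if (0%:E < r%:E)%E then r%:E - 0 else 0)%E.
  exact: (lebesgue_measure_itv `[0, r]).
rewrite lte_fin sube0; case: ltP => // r0'.
by congr EFin; apply/eqP; rewrite eq_le r0 r0'.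
Qed.

Lemma leb_unit_subset_fin (R : realType) (A : set (measurableTypeR R)) :
  measurable A -> A `<=` `[0, 1] -> leb R A \is a fin_num.
Proof.
move=> mA A01.
have le1 : (leb R A <= 1)%E.
  have -> : (1 = leb R `[0%R, 1%R]%classic)%E.
    by rewrite leb_itv0.
  by apply: le_measure => //; rewrite inE//; exact: measurable_itv.
rewrite ge0_fin_numE ?measure_ge0//.
by apply: le_lt_trans le1 _; exact: ltry.
Qed.

Section level_theory.
Context {d : measure_display} {T : measurableType d} {R : realType}.
Variables (C : T -> R -> nat).
Hypothesis clC : classifier C.

Lemma measurable_section (k : nat) (x : T) :
  measurable ([set u | C x u = k] : set (measurableTypeR R)).
Proof.
have := measurable_xsection x (clC.2 k).
by congr (measurable _); apply/seteqP; split => u; rewrite /xsection/= inE.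
Qed.

Lemma measurable_unit_section (k : nat) (x : T) :
  measurable (`[0, 1] `&` [set u | C x u = k] : set (measurableTypeR R)).
Proof.
apply: measurableI; [exact: measurable_itv|exact: measurable_section].
Qed.

Lemma level_EFin (k : nat) (x : T) :
  (level C k x)%:E = leb R (`[0, 1] `&` [set u | C x u = k])%classic.
Proof.
rewrite /level fineK//.
exact: leb_unit_subset_fin (measurable_unit_section k x) (@subIsetl _ _ _).
Qed.

Lemma level_ge0 (k : nat) (x : T) : 0 <= level C k x.
Proof. by rewrite -lee_fin level_EFin measure_ge0. Qed.

(** The Lebesgue measure of the [x]-section of a product-measurable set is measurable in [x]; the
    set taken here is the level set of [C] cut down to [u] in the unit interval. *)
Lemma measurable_level (k : nat) : measurable_fun setT (level C k).
Proof.
pose A := [set z : T * measurableTypeR R | C z.1 z.2 = k]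
          `&` (setT `*` `[0, 1]).
have mA : measurable A.
  apply: measurableI; first exact: clC.2.
  by apply: measurableX => //; exact: measurable_itv.
have := measurable_fun_xsection (@lebesgue_measure R) mA.
move=> mf.
have := measurableT_comp (fine_measurable (@measurableT _ (\bar R))) mf.
apply: eq_measurable_fun => x _; rewrite /level /=; congr (fine (_ _)).
apply/seteqP; split=> u; rewrite /xsection /= inE /A/=.
  by move=> [? [? ?]]; split.
by move=> [? ?]; split.
Qed.

(** For fixed [x] the integrand is a simple function of [u], since [C x u] takes only the values 0,
    1 and 2. This is how [U] is integrated out of every probability and expectation below. *)
Lemma integral_unit_level (g : nat -> R) (x : T) : (forall k, 0 <= g k) ->
  (\int[leb R]_(u in `[0%R, 1%R]) (g (C x u))%:E =
   (g 0 * level C 0 x + g 1 * level C 1 x + g 2 * level C 2 x)%:E)%E.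
Proof.
move=> g0.
have m01 : measurable (`[0, 1] : set (measurableTypeR R)).
  exact: measurable_itv.
pose S (k : nat) : set (measurableTypeR R) := [set u | C x u = k].
have mS k : measurable (S k) by exact: measurable_section.
transitivity (\int[leb R]_(u in `[0%R, 1%R])
   \sum_(k <- [:: 0; 1; 2]%N) ((g k)%:E * (\1_(S k) u)%:E))%E.
  apply: eq_integral => u _; rewrite !big_cons big_nil /= adde0.
  have E (k : nat) : (u \in S k) = (C x u == k).
    by apply/idP/eqP; rewrite inE.
  rewrite !indicE !E; have := clC.1 x u.
  by case: (C x u) => [|[|[|]]]//= _;
     rewrite ?mule0 ?mule1 ?adde0 ?add0e.
rewrite ge0_integral_sum//; last 2 first.
- move=> k; apply: measurable_funeM; apply/measurable_EFinP.
  by apply: measurable_funTS; exact: measurable_indic.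
- by move=> k u _; rewrite mule_ge0// lee_fin// indicE.
have E k : (\int[leb R]_(u in `[0%R, 1%R]) ((g k)%:E * (\1_(S k) u)%:E) =
     (g k * level C k x)%:E)%E.
  rewrite ge0_integralZl//; last 2 first.
  - apply/measurable_EFinP.
    by apply: measurable_funTS; exact: measurable_indic.
  - by rewrite lee_fin.
  by rewrite integral_indic// EFinM level_EFin setIC.
by rewrite !big_cons big_nil !E adde0 addeA !EFinD.
Qed.

Lemma level_sum (x : T) : level C 0 x + level C 1 x + level C 2 x = 1.
Proof.
have := integral_unit_level (fun=> 1) x (fun=> ler01).
rewrite integral_cst/=; last exact: measurable_itv.
rewrite leb_itv0// mule1 !mul1r.
by move=> [<-].
Qed.

End level_theory.

(** * Integrals of nonnegative real-valued functions *)

Section integral_EFin.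
Context {d : measure_display} {T : measurableType d} {R : realType}.
Variable mu : {measure set T -> \bar R}.
Implicit Types f g : T -> R.

Lemma measurable_natr_bool (b : T -> bool) : measurable_fun setT b ->
  measurable_fun setT (fun x => (b x)%:R : R).
Proof.
move=> mb.
have -> : (fun x => (b x)%:R : R) = (fun x => if b x then 1 else 0).
  by apply/funext => x; case: (b x).
exact: measurable_fun_ifT.
Qed.

Lemma ge0_le_integral_EFin f g :
  measurable_fun setT f -> measurable_fun setT g ->
  (forall x, 0 <= f x) -> (forall x, f x <= g x) ->
  (\int[mu]_x (f x)%:E <= \int[mu]_x (g x)%:E)%E.
Proof.
move=> mf mg f0 fg; apply: ge0_le_integral => //.
- by move=> x _; rewrite lee_fin.
- exact/measurable_EFinP.
- exact/measurable_EFinP.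
- by move=> x _; rewrite lee_fin.
Qed.

Lemma ge0_integral_EFinD f g :
  measurable_fun setT f -> measurable_fun setT g ->
  (forall x, 0 <= f x) -> (forall x, 0 <= g x) ->
  (\int[mu]_x (f x + g x)%:E = \int[mu]_x (f x)%:E + \int[mu]_x (g x)%:E)%E.
Proof.
move=> mf mg f0 g0; under eq_integral do rewrite EFinD.
apply: ge0_integralD => //; try exact/measurable_EFinP.
- by move=> x _; rewrite lee_fin.
- by move=> x _; rewrite lee_fin.
Qed.

Lemma ge0_integral_EFinZ (c : R) f : 0 <= c ->
  measurable_fun setT f -> (forall x, 0 <= f x) ->
  (\int[mu]_x (c * f x)%:E = c%:E * \int[mu]_x (f x)%:E)%E.
Proof.
move=> c0 mf f0; under eq_integral do rewrite EFinM.
apply: ge0_integralZl => //; first exact/measurable_EFinP.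
by move=> x _; rewrite lee_fin.
Qed.

Lemma integral_set_bool (b : T -> bool) f :
  (\int[mu]_(x in [set x | b x]) (f x)%:E = \int[mu]_x (f x * (b x)%:R)%:E)%E.
Proof.
rewrite integral_mkcond; apply: eq_integral => x _.
rewrite patchE; case: ifPn => [|/negP]; rewrite in_setE /=.
  by move=> ->; rewrite mulr1.
by move/negP/negbTE=> ->; rewrite mulr0.
Qed.

(* Continuity from below of the measure with density [f]. *)
Lemma ge0_integral_bool_bigcup_le (c : \bar R) (B : nat -> T -> bool)
    (b : T -> bool) f :
  measurable_fun setT f -> (forall x, 0 <= f x) ->
  (forall n, measurable_fun setT (B n)) ->
  (forall n x, B n x -> B n.+1 x) ->
  (forall x, b x <-> exists n, B n x) ->
  (forall n, (\int[mu]_x (f x * (B n x)%:R)%:E <= c)%E) ->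
  (\int[mu]_x (f x * (b x)%:R)%:E <= c)%E.
Proof.
move=> mf f0 mB ndB bE Bc.
rewrite -integral_set_bool.
have -> : [set x | b x] = \bigcup_n [set x | B n x].
  apply/seteqP; split=> x /=.
    by move/bE => [n Bn]; exists n.
  by move=> [n _ Bn]; apply/bE; exists n.
have mS n : measurable [set x | B n x].
  by have := mB n measurableT [set true] I; rewrite setTI.
have cv : (\int[mu]_(x in [set x | B i x]) (f x)%:E @[i --> \oo] -->
    \int[mu]_(x in \bigcup_i [set x | B i x]) (f x)%:E)%E.
  apply: ge0_nondecreasing_set_cvg_integral => //.
  - apply/nondecreasing_seqP => n; rewrite subsetEset => x /=; exact: ndB.
  - by move=> n; apply: measurable_funTS; exact/measurable_EFinP.
  - by move=> n x _; rewrite lee_fin.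
rewrite -(cvg_lim _ cv)//; apply: lime_le.
  by apply/cvg_ex; eexists; exact: cv.
by apply: nearW => n; rewrite integral_set_bool.
Qed.

End integral_EFin.

(** * Neyman-Pearson argument for an abstract density [m] and a function [M] between [m / 2] and
    [m] *)

Section neyman_pearson.
Context {d : measure_display} {T : measurableType d} {R : realType}.
Variable mu : {measure set T -> \bar R}.
Variables (m M : T -> R).
Hypotheses (mm : measurable_fun setT m) (mM : measurable_fun setT M).
Hypotheses (M_ge : forall x, m x <= 2 * M x) (M_le : forall x, M x <= m x).
Hypothesis im : (\int[mu]_x (m x)%:E = 1)%E.

Lemma mixture_ge0 (x : T) : 0 <= m x.
Proof. have := M_ge x; have := M_le x; lra. Qed.

(** Domination by [m] makes the integral a real number, which allows cancellation and linear
    arithmetic in place of extended-real identities. *)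
Lemma weighted_integral_fin (f : T -> R) : measurable_fun setT f ->
  (forall x, 0 <= f x <= m x) ->
  exists2 v : R, (\int[mu]_x (f x)%:E = v%:E)%E & 0 <= v <= 1.
Proof.
move=> mf f0.
have i0 : (0 <= \int[mu]_x (f x)%:E)%E.
  by apply: integral_ge0 => x _; rewrite lee_fin; case/andP: (f0 x).
have i1 : (\int[mu]_x (f x)%:E <= 1)%E.
  rewrite -im; apply: ge0_le_integral_EFin => // x; by case/andP: (f0 x).
have fn : (\int[mu]_x (f x)%:E)%E \is a fin_num.
  by rewrite ge0_fin_numE//; apply: le_lt_trans i1 (ltry _).
exists (fine (\int[mu]_x (f x)%:E)%E); first by rewrite fineK.
by rewrite -!lee_fin fineK// i0 i1.
Qed.

(** Pointwise, [(tau m - M)(a - b)] is at most [m a] where [M < tau m], at most [m (1 - a)] where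
    [M > tau m], and zero on ties. The two bounds integrate to zero by assumption, and the terms in
    [1 - tau] cancel because [a] and [b] have the same mass under [m]. *)
Lemma threshold_rule_optimal (tau : R) (a b : T -> R) :
  0 <= tau <= 1 ->
  measurable_fun setT a -> measurable_fun setT b ->
  (forall x, 0 <= a x <= 1) -> (forall x, 0 <= b x <= 1) ->
  (\int[mu]_x (m x * a x)%:E = \int[mu]_x (m x * b x)%:E)%E ->
  (\int[mu]_x (m x * (M x < tau * m x)%R%:R * a x)%:E = 0)%E ->
  (\int[mu]_x (m x * (tau * m x < M x)%R%:R * (1 - a x))%:E = 0)%E ->
  (\int[mu]_x ((m x - M x) * a x)%:E <= \int[mu]_x ((m x - M x) * b x)%:E)%E.
Proof.
move=> /andP[t0 t1] ma mb a01 b01 ab z1 z2.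
have m0 := mixture_ge0.
have mh : measurable_fun setT (fun x => m x - M x) by exact: measurable_funB.
have mtm : measurable_fun setT (fun x => tau * m x) by exact: measurable_funM.
have mha : measurable_fun setT (fun x => (m x - M x) * a x).
  exact: measurable_funM.
have mhb : measurable_fun setT (fun x => (m x - M x) * b x).
  exact: measurable_funM.
have mma : measurable_fun setT (fun x => m x * a x) by exact: measurable_funM.
have mmb : measurable_fun setT (fun x => m x * b x) by exact: measurable_funM.
have mz1 : measurable_fun setT (fun x => m x * (M x < tau * m x)%R%:R * a x).
  apply: measurable_funM => //; apply: measurable_funM => //.
  by apply: measurable_natr_bool; exact: measurable_fun_ltr.
have mz2 : measurable_fun setT
    (fun x => m x * (tau * m x < M x)%R%:R * (1 - a x)).
  apply: measurable_funM; last exact: measurable_funB.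
  apply: measurable_funM => //.
  by apply: measurable_natr_bool; exact: measurable_fun_ltr.
have h0 x : 0 <= m x - M x by rewrite subr_ge0.
have a0 x : 0 <= a x by case/andP: (a01 x).
have b0 x : 0 <= b x by case/andP: (b01 x).
have a1 x : 0 <= 1 - a x by rewrite subr_ge0; case/andP: (a01 x).
have c0 : 0 <= 1 - tau by lra.
(* The pointwise bound, with every negative term moved to the other side: all integrands are
   nonnegative, so the integrals split without any integrability argument. *)
have key : (\int[mu]_x ((m x - M x) * a x + (1 - tau) * (m x * b x))%:E <=
    \int[mu]_x ((((m x - M x) * b x + (1 - tau) * (m x * a x)) +
      m x * (M x < tau * m x)%R%:R * a x) +
      m x * (tau * m x < M x)%R%:R * (1 - a x))%:E)%E.
  apply: ge0_le_integral_EFin.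
  - by apply: measurable_funD => //; exact: measurable_funM.
  - do 3 (apply: measurable_funD => //); exact: measurable_funM.
  - by move=> x; rewrite addr_ge0 ?mulr_ge0.
  move=> x; have := m0 x; have := h0 x; have := a01 x; have := b01 x.
  have := M_ge x.
  move: (m x) (M x) (a x) (b x) => p q s t Mg /andP[? ?] /andP[? ?] ? ?.
  (* In the two strict cases [H1] discards the competitor [t = b x], and [H2] bounds [|tau m - M|]
     by [m], using [0 <= M <= m] and [0 <= tau <= 1]. *)
  case: (ltgtP q (tau * p)) => /= H; rewrite ?mulr0 ?mulr1 ?mul0r ?addr0.
  - have H1 : 0 <= (tau * p - q) * t by rewrite mulr_ge0// subr_ge0 ltW.
    have H2 : 0 <= (p - tau * p + q) * s by rewrite mulr_ge0//; nra.
    lra.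
  - have H1 : 0 <= (q - tau * p) * (1 - t) by rewrite mulr_ge0 ?subr_ge0// ltW.
    have H2 : 0 <= (p - q + tau * p) * (1 - s).
      by rewrite mulr_ge0 ?subr_ge0//; nra.
    lra.
  - by rewrite H; lra.
rewrite !ge0_integral_EFinD ?ge0_integral_EFinZ// ?z1 ?z2 in key.
all: try by move=> x; rewrite ?addr_ge0 ?mulr_ge0.
all: try by do ?(apply: measurable_funD => //); exact: measurable_funM.
rewrite ab !adde0 in key.
(* The common mass can be cancelled only once the integrals are known to be finite. *)
have bd (f : T -> R) : (forall x, 0 <= f x <= 1) ->
    forall x, 0 <= m x * f x <= m x.
  by move=> f01 x; have := m0 x; have := f01 x => /andP[? ?] ?; nra.
have bdh (f : T -> R) : (forall x, 0 <= f x <= 1) ->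
    forall x, 0 <= (m x - M x) * f x <= m x.
  move=> f01 x; have := m0 x; have := h0 x; have := M_ge x.
  by have := f01 x => /andP[? ?] ? ? ?; nra.
have [v1 e1 _] := weighted_integral_fin _ mha (bdh _ a01).
have [v2 e2 _] := weighted_integral_fin _ mhb (bdh _ b01).
have [v3 e3 _] := weighted_integral_fin _ mmb (bd _ b01).
rewrite e1 e2 e3 -EFinM -!EFinD !lee_fin in key *.
by rewrite lerD2r in key.
Qed.

(** Take for [tau] the largest [t] in [[1/2, 1]] for which [M < t m] has mass at most [gamma]. The
    mass strictly below the threshold is then at most [gamma] and the mass strictly above at most
    [1 - gamma], so a fraction [r] of the tie fills the gap. *)
Lemma exists_threshold (gamma : R) : 0 <= gamma <= 1 ->
  exists tau r : R, [/\ 1 / 2 <= tau <= 1, 0 <= r <= 1 &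
    (\int[mu]_x (m x * ((M x < tau * m x)%R%:R
                        + r * (M x == tau * m x)%:R))%:E = gamma%:E)%E].
Proof.
move=> /andP[ga0 ga1].
have m0 := mixture_ge0.
have mtm t : measurable_fun setT (fun x => t * m x) by exact: measurable_funM.
have mlt t : measurable_fun setT (fun x => M x < t * m x).
  exact: measurable_fun_ltr.
have mgt t : measurable_fun setT (fun x => t * m x < M x).
  exact: measurable_fun_ltr.
have meq t : measurable_fun setT (fun x => M x == t * m x).
  exact: measurable_fun_eqr.
have mmb (b : T -> bool) : measurable_fun setT b ->
    measurable_fun setT (fun x => m x * (b x)%:R).
  by move=> mb; apply: measurable_funM => //; exact: measurable_natr_bool.
have mb0 (b : T -> bool) x : 0 <= m x * (b x)%:R by rewrite mulr_ge0.
(* Masses of the ratio [M / m] below, above and at [t], written without division so that points with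
   [m = 0] need no separate treatment. *)
pose F t := (\int[mu]_x (m x * (M x < t * m x)%R%:R)%:E)%E.
pose G t := (\int[mu]_x (m x * (t * m x < M x)%R%:R)%:E)%E.
pose E t := (\int[mu]_x (m x * (M x == t * m x)%:R)%:E)%E.
have FGE t : (F t + G t + E t = 1)%E.
  rewrite /F /G /E -!ge0_integral_EFinD// -?im.
  all: try exact: mmb.
  all: try by move=> x; rewrite ?addr_ge0 ?mulr_ge0.
  all: try by apply: measurable_funD; exact: mmb.
  apply: eq_integral => x _; congr EFin.
  by case: (ltgtP (M x) (t * m x)) => _; rewrite ?mulr1 ?mulr0; lra.
have fin (b : T -> bool) : measurable_fun setT b ->
    exists2 v : R, (\int[mu]_x (m x * (b x)%:R)%:E = v%:E)%E & 0 <= v <= 1.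
  move=> mb; apply: weighted_integral_fin; first exact: mmb.
  by move=> x; case: (b x); rewrite ?mulr1 ?mulr0 ?m0 ?lexx.
have F_mono : forall s t, s <= t -> (F s <= F t)%E.
  move=> s t st; apply: ge0_le_integral_EFin => //; try exact: mmb.
    by move=> x; rewrite mulr_ge0.
  move=> x; apply: ler_wpM2l => //; rewrite ler_nat.
  case: ltP => // H; rewrite (lt_le_trans H)//.
  exact: ler_wpM2r.
pose S := [set t : R | 1 / 2 <= t <= 1 /\ (F t <= gamma%:E)%E].
(* Since [m <= 2 M], the ratio is never below one half and [F (1 / 2)] is zero. *)
have Shalf : S (1 / 2).
  split; first by lra.
  rewrite /F integral0_eq ?lee_fin// => x _.
  by rewrite ltNge (_ : _ <= _ = true) ?mulr0//; have := M_ge x; lra.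
have Sub : ubound S 1 by move=> t [/andP[]].
have hS : has_sup S by split; [exists (1/2)|exists 1].
pose tau := sup S.
have tau_ge : 1 / 2 <= tau by apply: ub_le_sup => //; exists 1.
have tau_le : tau <= 1 by apply: ge_sup => //; exists (1 / 2).
(* A strict inequality at [tau] persists at [tau - 1/(n+1)] or [tau + 1/(n+1)] for some [n]; this
   writes the two strict regions as increasing unions. *)
have archi x : forall e : R, 0 < e -> exists n : nat, n.+1%:R^-1 * m x < e.
  move=> e e0; exists (Num.bound (m x / e)).
  rewrite mulrC ltr_pdivrMr//.
  have := archi_boundP (divr_ge0 (m0 x) (ltW e0)).
  rewrite ltr_pdivrMr// => H; apply: lt_trans H _.
  by rewrite mulrC ltr_pM2l// ltr_nat.
have invS (n : nat) : n.+2%:R^-1 <= n.+1%:R^-1 :> R.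
  by rewrite lef_pV2 ?posrE// ler_nat.
have inv0 (n : nat) : 0 < n.+1%:R^-1 :> R by rewrite invr_gt0.
(* Continuity from below: some element of [S] exceeds [tau - 1/(n+1)], so by monotonicity of [F]
   each approximating region has mass at most [gamma]. *)
have Ftau : (F tau <= gamma%:E)%E.
  apply: (ge0_integral_bool_bigcup_le _ _
    (fun n x => M x < (tau - n.+1%:R^-1) * m x)) => //.
  - move=> n x H; apply: lt_le_trans H _; apply: ler_wpM2r => //.
    by rewrite lerD2l lerN2.
  - move=> x; split=> [|[n]] H.
      have [|n nH] := archi x (tau * m x - M x); first by rewrite subr_gt0.
      by exists n; rewrite mulrBl ltrBrDr -ltrBrDl.
    apply: lt_le_trans H _; apply: ler_wpM2r => //.
    by rewrite gerBl ltW.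
  - move=> n; have [t [_ Ft] tt] := sup_adherent (inv0 n) hS.
    by apply: le_trans Ft; apply: F_mono; exact: ltW.
(* Continuity from below again, now with [t = tau + 1/(n+1)], which lies beyond the supremum of
   [S]. *)
have Gtau : (G tau <= (1 - gamma)%:E)%E.
  apply: (ge0_integral_bool_bigcup_le _ _
    (fun n x => (tau + n.+1%:R^-1) * m x < M x)) => //.
  - move=> n x H; apply: le_lt_trans H; apply: ler_wpM2r => //.
    by rewrite lerD2l.
  - move=> x; split=> [|[n]] H.
      have [|n nH] := archi x (M x - tau * m x); first by rewrite subr_gt0.
      by exists n; rewrite mulrDl -ltrBrDl.
    apply: le_lt_trans H; apply: ler_wpM2r => //.
    by rewrite lerDl ltW.
  - move=> n; have i0 := inv0 n; set t := tau + _.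
    (* If [t > 1], the region [t m < M] is empty because [M <= m]. Otherwise [t] is outside [S], so
       [F t > gamma] and [G t <= 1 - F t] gives the bound. *)
    have [t1|t1] := leP t 1; last first.
      rewrite integral0_eq ?lee_fin ?subr_ge0// => x _.
      rewrite ltNge (_ : _ <= _ = true) ?mulr0//.
      by apply: le_trans (M_le x) _; rewrite ler_peMl// ltW.
    have : (gamma%:E < F t)%E.
      rewrite ltNge; apply/negP => Ft.
      have : t <= tau.
        apply: ub_le_sup; first by exists 1.
        by split=> //; rewrite t1 andbT (le_trans tau_ge)// lerDl ltW.
      by rewrite /t gerDl leNgt i0.
    have := FGE t; rewrite -/(G t) /F /G /E.
    have [v1 -> _] := fin _ (mlt t); have [v2 -> _] := fin _ (mgt t).
    have [v3 -> /andP[? _]] := fin _ (meq t).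
    by rewrite -!EFinD lte_fin lee_fin => -[] ?; lra.
have := FGE tau; move: Ftau Gtau.
have mz : measurable_fun setT (fun x => (M x < tau * m x)%R%:R : R).
  exact: measurable_natr_bool.
have split_int r : 0 <= r ->
  (\int[mu]_x (m x * ((M x < tau * m x)%R%:R
      + r * (M x == tau * m x)%:R))%:E = F tau + r%:E * E tau)%E.
  move=> r0; rewrite /E /F -ge0_integral_EFinZ// -?ge0_integral_EFinD//.
  all: try by move=> x; rewrite ?mulr_ge0.
  all: try exact: mmb.
  all: try by apply: measurable_funM => //; exact: mmb.
  by apply: eq_integral => x _; congr EFin; ring.
have [v1 e1 _] := fin _ (mlt tau); have [v2 e2 _] := fin _ (mgt tau).
have [v3 e3 /andP[v3_ge0 _]] := fin _ (meq tau).
rewrite /F /G /E in split_int *; rewrite e1 e2 e3 in split_int *.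
rewrite -!EFinD !lee_fin => H1 H2 [] H3.
(* With a massless tie the two bounds force [F tau = gamma], and [r = 0] will do. Otherwise [r] is
   the missing mass [gamma - v1] as a fraction of the tie, at most 1 by the bound on [G tau]. *)
have [v30|v30] := eqVneq v3 0.
  exists tau, 0; split; [by rewrite tau_ge|by rewrite lexx ler01|].
  by rewrite split_int// v30 mule0 adde0; congr EFin; lra.
have v3_gt0 : 0 < v3 by rewrite lt_neqAle eq_sym v30.
have r0 : 0 <= (gamma - v1) / v3 by rewrite divr_ge0// subr_ge0.
exists tau, ((gamma - v1) / v3); split; first by rewrite tau_ge.
- by rewrite r0 ler_pdivrMr// mul1r; lra.
- by rewrite split_int// -EFinM -EFinD divfK//; congr EFin; ring.
Qed.

End neyman_pearson.

(** * The two-class mixture and its regression function [eta] *)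

Section indecision_risk.
Context {d : measure_display} {T : measurableType d} {R : realType}.
Variables (mu : {measure set T -> \bar R}) (f1 f2 : T -> R) (p1 p2 : R).
Hypotheses (mf1 : measurable_fun setT f1) (mf2 : measurable_fun setT f2).
Hypotheses (f1_ge0 : forall x, 0 <= f1 x) (f2_ge0 : forall x, 0 <= f2 x).
Hypotheses (if1 : (\int[mu]_x (f1 x)%:E = 1)%E)
           (if2 : (\int[mu]_x (f2 x)%:E = 1)%E).
Hypotheses (p1_gt0 : 0 < p1) (p2_gt0 : 0 < p2) (p12 : p1 + p2 = 1).

Let m := mixdens f1 f2 p1 p2.
Let M x := Num.max (p1 * f1 x) (p2 * f2 x).
Let eta := etaf f1 f2 p1 p2.

Let g1_ge0 x : 0 <= p1 * f1 x. Proof. by rewrite mulr_ge0// ltW. Qed.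
Let g2_ge0 x : 0 <= p2 * f2 x. Proof. by rewrite mulr_ge0// ltW. Qed.
Let mg1 : measurable_fun setT (fun x => p1 * f1 x).
Proof. exact: measurable_funM. Qed.
Let mg2 : measurable_fun setT (fun x => p2 * f2 x).
Proof. exact: measurable_funM. Qed.
Let mm : measurable_fun setT m. Proof. exact: measurable_funD. Qed.
Let mM : measurable_fun setT M. Proof. exact: measurable_maxr. Qed.
Let m_ge0 x : 0 <= m x. Proof. by rewrite addr_ge0. Qed.

Lemma mixdens_le_max x : m x <= 2 * M x.
Proof. by rewrite /m /mixdens /M; case: (leP (p1 * f1 x)) => ?; lra. Qed.

Lemma max_le_mixdens x : M x <= m x.
Proof.
have := g1_ge0 x; have := g2_ge0 x.
by rewrite /m /mixdens /M; case: (leP (p1 * f1 x)) => ? ? ?; lra.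
Qed.

Lemma mixdens_sub_max x : m x - M x = Num.min (p1 * f1 x) (p2 * f2 x).
Proof. by rewrite /m /mixdens /M; case: (leP (p1 * f1 x)) => ?; lra. Qed.

Lemma integral_mixdens : (\int[mu]_x (m x)%:E = 1)%E.
Proof.
rewrite /m /mixdens ge0_integral_EFinD// !ge0_integral_EFinZ// ?ltW//.
by rewrite if1 if2 !mule1 -EFinD p12.
Qed.

(** For [m > 0], [M < tau m] says that both [eta] and [1 - eta] are below [tau]. The factor [m]
    removes the points where [eta] is a division by zero. *)
Lemma mixdens_etaf_in_itvoo tau x :
  m x * (1 - tau < eta x < tau)%R%:R = m x * (M x < tau * m x)%R%:R.
Proof.
have [m0|m0] := eqVneq (m x) 0; first by rewrite m0 !mul0r.
have mp : 0 < m x by rewrite lt_neqAle eq_sym m0 m_ge0.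
congr (_ * _%:R); congr nat_of_bool.
rewrite /eta /etaf -/m ltr_pdivlMr// ltr_pdivrMr// /M gt_max andbC.
congr (_ && _); rewrite /m /mixdens.
by apply/idP/idP => H; lra.
Qed.

Lemma mixdens_etaf_notin_itvcc tau x :
  m x * (~~ (1 - tau <= eta x <= tau)%R)%:R = m x * (tau * m x < M x)%R%:R.
Proof.
have [m0|m0] := eqVneq (m x) 0; first by rewrite m0 !mul0r.
have mp : 0 < m x by rewrite lt_neqAle eq_sym m0 m_ge0.
congr (_ * _%:R); congr nat_of_bool.
rewrite /eta /etaf -/m ler_pdivlMr// ler_pdivrMr// ltNge /M ge_max andbC.
congr (~~ (_ && _)); rewrite /m /mixdens.
by apply/idP/idP => H; lra.
Qed.

(** Where [m = 0] both [p1 f1] and [p2 f2] vanish by nonnegativity, so the identity survives the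
    division by zero in [eta]. *)
Lemma mixdens_min_etaf x :
  m x * Num.min (eta x) (1 - eta x) = m x - M x.
Proof.
rewrite mixdens_sub_max minr_pMr// mulrBr mulr1 /eta /etaf -/m.
have [m0|m0] := eqVneq (m x) 0.
  rewrite m0 !mul0r subr0.
  have [-> ->] : p1 * f1 x = 0 /\ p2 * f2 x = 0.
    move: m0; rewrite /m /mixdens; have := g1_ge0 x; have := g2_ge0 x.
    by move=> ? ? ?; split; lra.
  by [].
have -> : m x * (p1 * f1 x / m x) = p1 * f1 x by rewrite mulrCA divff ?mulr1.
by rewrite /m /mixdens addrAC subrr add0r.
Qed.

(** * Probabilities and almost sure conditions in terms of levels *)

Section classifier_levels.
Variable C : T -> R -> nat.
Hypothesis clC : classifier C.

(** The event may depend on [x] as well as on the answer and the label, so that the almost sure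
    conditions on [eta] are covered too. *)
Lemma Prob_level (e : T -> nat -> nat -> bool) :
  (Prob mu f1 f2 p1 p2 (fun x u y => e x (C x u) y) =
   \int[mu]_x
     ((p1 * f1 x * (e x 0 1)%:R + p2 * f2 x * (e x 0 2)%:R) * level C 0 x +
      (p1 * f1 x * (e x 1 1)%:R + p2 * f2 x * (e x 1 2)%:R) * level C 1 x +
      (p1 * f1 x * (e x 2 1)%:R + p2 * f2 x * (e x 2 2)%:R) *
      level C 2 x)%:E)%E.
Proof.
apply: eq_integral => x _.
rewrite (integral_unit_level C clC (fun k =>
  p1 * f1 x * (e x k 1)%:R + p2 * f2 x * (e x k 2)%:R))//.
by move=> k; rewrite addr_ge0// mulr_ge0.
Qed.

Let l12 x : level C 1 x + level C 2 x = 1 - level C 0 x.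
Proof. by rewrite -(level_sum C clC x); ring. Qed.

Lemma level0_itv x : 0 <= level C 0 x <= 1.
Proof.
have := level_ge0 C clC 0 x; have := level_ge0 C clC 1 x.
by have := level_ge0 C clC 2 x; have := level_sum C clC x; lra.
Qed.

Lemma Pindec_level :
  Pindec mu f1 f2 p1 p2 C = (\int[mu]_x (m x * level C 0 x)%:E)%E.
Proof.
rewrite /Pindec (Prob_level (fun _ k _ => k == 0%N)) /=.
by apply: eq_integral => x _; congr EFin; rewrite /m /mixdens; ring.
Qed.

Lemma Prob_decision_level :
  Prob mu f1 f2 p1 p2 (fun x u _ => C x u != 0%N) =
  (\int[mu]_x (m x * (1 - level C 0 x))%:E)%E.
Proof.
rewrite (Prob_level (fun _ k _ => k != 0%N)) /=.
by apply: eq_integral => x _; congr EFin; rewrite -l12 /m /mixdens; ring.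
Qed.

Lemma Prob_error_level :
  Prob mu f1 f2 p1 p2 (fun x u y => (C x u != y) && (C x u != 0%N)) =
  (\int[mu]_x (p2 * f2 x * level C 1 x + p1 * f1 x * level C 2 x)%:E)%E.
Proof.
rewrite (Prob_level (fun _ k y => (k != y) && (k != 0%N))) /=.
by apply: eq_integral => x _; congr EFin; ring.
Qed.

Lemma Expect_min_level :
  Expect mu f1 f2 p1 p2 (fun x u => Num.min (eta x) (1 - eta x)
                                     * (C x u != 0%N)%:R) =
  (\int[mu]_x ((m x - M x) * (1 - level C 0 x))%:E)%E.
Proof.
apply: eq_integral => x _.
rewrite (integral_unit_level C clC (fun k => m x *
   (Num.min (eta x) (1 - eta x) * (k != 0%N)%:R))).
  by rewrite -l12 -mixdens_min_etaf /=; congr EFin; ring.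
by move=> k; rewrite mulrA mixdens_min_etaf mulr_ge0// subr_ge0 max_le_mixdens.
Qed.

(** With [a = 1 - level C 0], this supplies the first vanishing condition of
    [threshold_rule_optimal]; [as_indecide_level] supplies the second. *)
Lemma as_decide_level tau :
  as_ mu f1 f2 p1 p2 (fun x u => (1 - tau < eta x < tau) ==> (C x u == 0%N)) ->
  (\int[mu]_x (m x * (M x < tau * m x)%R%:R * (1 - level C 0 x))%:E = 0)%E.
Proof.
rewrite /as_ (Prob_level (fun x k _ =>
  ~~ ((1 - tau < eta x < tau) ==> (k == 0%N)))).
move=> <-; apply: eq_integral => x _; congr EFin.
rewrite -mixdens_etaf_in_itvoo -l12 /= implybT.
by rewrite !implybF !negbK /m /mixdens /=; ring.
Qed.

Lemma as_indecide_level tau :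
  as_ mu f1 f2 p1 p2 (fun x u =>
    (C x u == 0%N) ==> (1 - tau <= eta x <= tau)) ->
  (\int[mu]_x (m x * (tau * m x < M x)%R%:R * level C 0 x)%:E = 0)%E.
Proof.
rewrite /as_ (Prob_level (fun x k _ =>
  ~~ ((k == 0%N) ==> (1 - tau <= eta x <= tau)))).
move=> <-; apply: eq_integral => x _; congr EFin.
by rewrite -mixdens_etaf_notin_itvcc /= /m /mixdens; ring.
Qed.

Lemma as_argmax_level :
  as_ mu f1 f2 p1 p2 (fun x u =>
    ((C x u == 1%N) ==> (p2 * f2 x <= p1 * f1 x)) &&
    ((C x u == 2%N) ==> (p1 * f1 x <= p2 * f2 x))) ->
  (\int[mu]_x (m x * (p1 * f1 x < p2 * f2 x)%R%:R * level C 1 x +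
               m x * (p2 * f2 x < p1 * f1 x)%R%:R * level C 2 x)%:E = 0)%E.
Proof.
rewrite /as_ (Prob_level (fun x k _ =>
  ~~ (((k == 1%N) ==> (p2 * f2 x <= p1 * f1 x)) &&
      ((k == 2%N) ==> (p1 * f1 x <= p2 * f2 x))))).
move=> <-; apply: eq_integral => x _; congr EFin.
by rewrite /= andbT -!ltNge /m /mixdens; ring.
Qed.

Let ml k : measurable_fun setT (level C k).
Proof. exact: measurable_level. Qed.
Let ml0 : measurable_fun setT (fun x => 1 - level C 0 x).
Proof. exact: measurable_funB. Qed.
Let mh : measurable_fun setT (fun x => (m x - M x) * (1 - level C 0 x)).
Proof. by apply: measurable_funM => //; exact: measurable_funB. Qed.
Let merr : measurable_fun setT
  (fun x => p2 * f2 x * level C 1 x + p1 * f1 x * level C 2 x).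
Proof. by apply: measurable_funD; exact: measurable_funM. Qed.
Let h_ge0 x : 0 <= (m x - M x) * (1 - level C 0 x).
Proof.
have /andP[_ ?] := level0_itv x.
by rewrite mulr_ge0// subr_ge0// max_le_mixdens.
Qed.
Let err_ge0 x : 0 <= p2 * f2 x * level C 1 x + p1 * f1 x * level C 2 x.
Proof. by rewrite addr_ge0// mulr_ge0// level_ge0. Qed.

(** Answering 1 costs [p2 f2] and answering 2 costs [p1 f1]; either is at least their minimum
    [m - M]. *)
Lemma residual_le_error :
  (\int[mu]_x ((m x - M x) * (1 - level C 0 x))%:E <=
   Prob mu f1 f2 p1 p2 (fun x u y => (C x u != y) && (C x u != 0%N)))%E.
Proof.
rewrite Prob_error_level; apply: ge0_le_integral_EFin => // x.
rewrite -l12 mulrDr; apply: lerD; apply: ler_wpM2r; rewrite ?level_ge0//.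
  by rewrite mixdens_sub_max ge_min lexx orbT.
by rewrite mixdens_sub_max ge_min lexx.
Qed.

(** An answer costs more than the minimum only where it picks the smaller [p_i f_i], and the excess
    is at most [m]. The integral of that bound is zero by [as_argmax_level]. *)
Lemma argmax_error :
  as_ mu f1 f2 p1 p2 (fun x u =>
    ((C x u == 1%N) ==> (p2 * f2 x <= p1 * f1 x)) &&
    ((C x u == 2%N) ==> (p1 * f1 x <= p2 * f2 x))) ->
  (Prob mu f1 f2 p1 p2 (fun x u y => (C x u != y) && (C x u != 0%N)) =
   \int[mu]_x ((m x - M x) * (1 - level C 0 x))%:E)%E.
Proof.
move=> /as_argmax_level z; apply/eqP; rewrite eq_le residual_le_error andbT.
rewrite Prob_error_level.
have mb (a b : T -> R) k : measurable_fun setT a -> measurable_fun setT b ->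
    measurable_fun setT (fun x => m x * (a x < b x)%R%:R * level C k x).
  move=> ma mb; apply: measurable_funM => //; apply: measurable_funM => //.
  by apply: measurable_natr_bool; exact: measurable_fun_ltr.
have mz : measurable_fun setT (fun x =>
    m x * (p1 * f1 x < p2 * f2 x)%R%:R * level C 1 x +
    m x * (p2 * f2 x < p1 * f1 x)%R%:R * level C 2 x).
  by apply: measurable_funD; exact: mb.
have z_ge0 x : 0 <= m x * (p1 * f1 x < p2 * f2 x)%R%:R * level C 1 x +
    m x * (p2 * f2 x < p1 * f1 x)%R%:R * level C 2 x.
  by rewrite addr_ge0 ?mulr_ge0 ?level_ge0.
rewrite -[leRHS]adde0 -z -ge0_integral_EFinD//.
apply: ge0_le_integral_EFin => //; first exact: measurable_funD.
move=> x; rewrite -l12 mixdens_sub_max.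
have := level_ge0 C clC 1 x; have := level_ge0 C clC 2 x.
have := g1_ge0 x; have := g2_ge0 x; rewrite /m /mixdens.
move: (p1 * f1 x) (p2 * f2 x) (level C 1 x) (level C 2 x) => a b s t ? ? ? ?.
by case: (ltgtP a b) => /= H; nra.
Qed.

Lemma Prob_decision gamma : Pindec mu f1 f2 p1 p2 C = gamma%:E ->
  Prob mu f1 f2 p1 p2 (fun x u _ => C x u != 0%N) = (1 - gamma)%:E.
Proof.
rewrite Pindec_level Prob_decision_level => e.
have l_ge0 x : 0 <= 1 - level C 0 x by have := level0_itv x; lra.
have l_ge0' x : 0 <= level C 0 x by have := level0_itv x; lra.
have [v ev _] : exists2 v : R,
    (\int[mu]_x (m x * (1 - level C 0 x))%:E = v%:E)%E & 0 <= v <= 1.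
  apply: (weighted_integral_fin _ _ mm integral_mixdens).
    exact: measurable_funM.
  move=> x; have := level0_itv x; have := m_ge0 x.
  move: (m x) (level C 0 x) => a b ? /andP[? ?]; nra.
have := integral_mixdens.
have -> : (\int[mu]_x (m x)%:E = \int[mu]_x
    (m x * level C 0 x + m x * (1 - level C 0 x))%:E)%E.
  by apply: eq_integral => x _; congr EFin; ring.
rewrite ge0_integral_EFinD//; first last.
all: try by move=> x; rewrite mulr_ge0.
all: try exact: measurable_funM.
by rewrite e ev -EFinD => -[] H; congr EFin; lra.
Qed.

(** Needed to pass from an inequality of error probabilities to one of their real parts [fine]; the
    error density is dominated by [m]. *)
Lemma Prob_error_fin :
  Prob mu f1 f2 p1 p2 (fun x u y => (C x u != y) && (C x u != 0%N))
    \is a fin_num.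
Proof.
rewrite Prob_error_level.
have [|v -> //] := weighted_integral_fin _ _ mm integral_mixdens _ merr.
move=> x; rewrite err_ge0 /= /m /mixdens addrC lerD// ler_piMr//.
  have := level_ge0 C clC 0 x; have := level_ge0 C clC 1 x.
  by have := level_sum C clC x; lra.
have := level_ge0 C clC 0 x; have := level_ge0 C clC 2 x.
by have := level_sum C clC x; lra.
Qed.

End classifier_levels.

(** * Optimality and the value of the risk *)

Lemma Ystar_residual_le gamma tau C C' : 1 / 2 <= tau <= 1 ->
  is_Ystar mu f1 f2 p1 p2 gamma tau C ->
  classifier C' -> Pindec mu f1 f2 p1 p2 C' = gamma%:E ->
  (\int[mu]_x ((m x - M x) * (1 - level C 0 x))%:E <=
   \int[mu]_x ((m x - M x) * (1 - level C' 0 x))%:E)%E.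
Proof.
move=> /andP[t0 t1] [clC iC a1 a2 a3] clC' iC'.
apply: (threshold_rule_optimal _ _ _ mm mM mixdens_le_max max_le_mixdens
  integral_mixdens tau).
- by rewrite t1 andbT; lra.
- by apply: measurable_funB => //; exact: measurable_level.
- by apply: measurable_funB => //; exact: measurable_level.
- by move=> x; have := level0_itv C clC x; lra.
- by move=> x; have := level0_itv C' clC' x; lra.
- by rewrite -!Prob_decision_level// !(Prob_decision _ _ gamma).
- exact: as_decide_level.
- rewrite -[RHS](as_indecide_level C clC tau a2).
  by apply: eq_integral => x _; rewrite subKr.
Qed.

(** All competitors share the denominator [1 - gamma > 0], so only error probabilities are compared:
    that of [C] equals its residual, which is at most the residual of [C'] and hence the error of
    [C']. As [C] is itself a competitor, the infimum is attained. *)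
Lemma Ystar_risk gamma tau C : 1 / 2 <= tau <= 1 -> gamma < 1 ->
  is_Ystar mu f1 f2 p1 p2 gamma tau C ->
  Rrisk mu f1 f2 p1 p2 gamma = cond_err mu f1 f2 p1 p2 C.
Proof.
move=> t01 g1 YC; have [clC iC _ _ a3] := YC.
have lb : lbound [set cond_err mu f1 f2 p1 p2 C | C in
    [set C | classifier C /\ Pindec mu f1 f2 p1 p2 C = gamma%:E]]
    (cond_err mu f1 f2 p1 p2 C).
  move=> _ [C' [clC' iC'] <-].
  rewrite /cond_err (Prob_decision _ clC _ iC) (Prob_decision _ clC' _ iC') /=.
  rewrite ler_pM2r ?invr_gt0 ?subr_gt0// fine_le ?Prob_error_fin//.
  rewrite argmax_error//.
  apply: le_trans (residual_le_error _ clC').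
  exact: (Ystar_residual_le gamma tau).
apply/eqP; rewrite eq_le; apply/andP; split.
  by apply: ge_inf; [exists (cond_err mu f1 f2 p1 p2 C)|exists C].
by apply: lb_le_inf => //; exists (cond_err mu f1 f2 p1 p2 C), C.
Qed.

Lemma Ystar_risk_residual gamma tau C : 1 / 2 <= tau <= 1 -> gamma < 1 ->
  is_Ystar mu f1 f2 p1 p2 gamma tau C ->
  Rrisk mu f1 f2 p1 p2 gamma =
  fine (\int[mu]_x ((m x - M x) * (1 - level C 0 x))%:E)%E / (1 - gamma).
Proof.
move=> t01 g1 YC; rewrite (Ystar_risk gamma tau C)//.
have [clC iC _ _ a3] := YC.
by rewrite /cond_err (Prob_decision _ clC _ iC) argmax_error.
Qed.

(** Without randomization on the unit interval, [level C 0 x] is 1 or 0 according to whether [C0 x]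
    is 0, so [1 - level C 0] is the indicator of the decision set. *)
Lemma deterministic_residual C C0 : classifier C ->
  (forall x u, 0 <= u <= 1 -> C x u = C0 x) ->
  (\int[mu]_x ((m x - M x) * (1 - level C 0 x))%:E =
   \int[mu]_(x in [set x | C0 x != 0%N])
     (Num.min (p1 * f1 x) (p2 * f2 x))%:E)%E.
Proof.
move=> clC CC0; rewrite integral_set_bool.
apply: eq_integral => x _; rewrite mixdens_sub_max; congr (_ * _)%:E.
rewrite /level; have [c0|c0] /= := eqVneq (C0 x) 0%N.
  rewrite (_ : _ `&` _ = `[0, 1]%classic) ?leb_itv0//= ?subrr//.
  apply/seteqP; split=> u /=; first by case.
  by move=> u01; split=> //; rewrite CC0// -in_itv.
rewrite (_ : _ `&` _ = set0) ?measure0 ?subr0//.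
apply/seteqP; split=> u //= [u01]; rewrite CC0; first by move/eqP: c0.
by rewrite in_itv in u01.
Qed.

(** * Existence of an optimal classifier *)

Definition threshold_classifier (tau r : R) (x : T) (u : R) : nat :=
  if (M x < tau * m x) || ((M x == tau * m x) && (u <= r)) then 0%N
  else if p2 * f2 x <= p1 * f1 x then 1%N else 2%N.

Lemma classifier_threshold tau r : classifier (threshold_classifier tau r).
Proof.
split=> [x u|k].
  by rewrite /threshold_classifier; case: ifP => // _; case: ifP.
have mfst (f : T -> R) : measurable_fun setT f ->
    measurable_fun setT (fun z : T * measurableTypeR R => f z.1).
  by move=> mf; exact: measurableT_comp.
have mC : measurable_fun setT (fun z : T * measurableTypeR R =>
    threshold_classifier tau r z.1 z.2).
  have mtm : measurable_fun setT (fun x => tau * m x) by exact: measurable_funM.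
  apply: measurable_fun_ifT => //; last first.
    apply: measurable_fun_ifT => //.
    by apply: measurable_fun_ler; [exact: (mfst _ mg2)|exact: (mfst _ mg1)].
  apply: measurable_or; first
    exact: (measurable_fun_ltr (mfst _ mM) (mfst _ mtm)).
  apply: measurable_and; first
    exact: (measurable_fun_eqr (mfst _ mM) (mfst _ mtm)).
  by apply: measurable_fun_ler => //; exact: measurable_snd.
by have := mC measurableT [set k] I; rewrite setTI.
Qed.

Lemma level0_threshold tau r x : 0 <= r <= 1 ->
  level (threshold_classifier tau r) 0 x =
  (M x < tau * m x)%R%:R + r * (M x == tau * m x)%:R.
Proof.
move=> /andP[r0 r1]; rewrite /level /threshold_classifier.
case: (ltgtP (M x) (tau * m x)) => /= H; rewrite ?mulr0 ?mulr1 ?addr0 ?add0r.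
- rewrite (_ : _ `&` _ = `[0, 1]%classic) ?leb_itv0//.
  by apply/seteqP; split=> u //= [].
- rewrite (_ : _ `&` _ = set0) ?measure0//.
  by apply/seteqP; split=> u //= []; case: ifP.
- rewrite (_ : _ `&` _ = `[0, r]%classic) ?leb_itv0//.
  apply/seteqP; split=> u /=; rewrite !in_itv /=.
    by move=> [/andP[-> _]]; case: ifP => //; case: ifP.
  by move=> /andP[-> ur]; rewrite ur (le_trans ur).
Qed.

(** Failures of [Q] are harmless where [m = 0], a null set for the law of [X]; this matters since
    [eta] carries no information there. *)
Lemma as_pointwise (Q : T -> R -> bool) :
  (forall x u, m x * (~~ Q x u)%:R = 0) -> as_ mu f1 f2 p1 p2 Q.
Proof.
move=> Q0; rewrite /as_ /Prob integral0_eq// => x _.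
by rewrite integral0_eq// => u _; rewrite -mulrDl -/(mixdens _ _ _ _ x) Q0.
Qed.

(** The threshold and tie fraction from [exists_threshold] give indecision probability exactly
    [gamma]; the three almost sure conditions then hold pointwise after weighting by [m]. *)
Lemma exists_Ystar gamma : 0 <= gamma < 1 -> exists tau,
  1 / 2 <= tau <= 1 /\ exists C, is_Ystar mu f1 f2 p1 p2 gamma tau C.
Proof.
move=> /andP[g0 g1].
have [|tau [r [t01 r01 e]]] := exists_threshold _ _ _ mm mM mixdens_le_max
  max_le_mixdens integral_mixdens gamma.
  by rewrite g0 ltW.
have clC := classifier_threshold tau r.
exists tau; split=> //; exists (threshold_classifier tau r); split=> //.
- rewrite Pindec_level// -e; apply: eq_integral => x _.
  by rewrite level0_threshold.
- apply: as_pointwise => x u; rewrite negb_imply -mulnb natrM mulrA.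
  rewrite mixdens_etaf_in_itvoo /threshold_classifier.
  by case: (ltgtP (M x)); rewrite /= ?mulr0 ?mul0r.
- apply: as_pointwise => x u; rewrite negb_imply andbC -mulnb natrM mulrA.
  rewrite mixdens_etaf_notin_itvcc /threshold_classifier.
  by case: (ltgtP (M x)); rewrite /= ?mulr0 ?mul0r//; case: ifP; rewrite mulr0.
- apply: as_pointwise => x u; rewrite /threshold_classifier.
  case: ifP => _; first by rewrite mulr0.
  by case: leP => //= H; rewrite ?mulr0// ltW//= mulr0.
Qed.

End indecision_risk.

Theorem theorem1 (d : measure_display) (T : measurableType d) (R : realType)
  (mu : {measure set T -> \bar R}) (f1 f2 : T -> R) (p1 p2 : R) :
  sigma_finite setT mu ->
  measurable_fun setT f1 -> measurable_fun setT f2 ->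
  (forall x, 0 <= f1 x) -> (forall x, 0 <= f2 x) ->
  (\int[mu]_x (f1 x)%:E = 1)%E -> (\int[mu]_x (f2 x)%:E = 1)%E ->
  (exists A, measurable A /\
     (\int[mu]_(x in A) (f1 x)%:E != \int[mu]_(x in A) (f2 x)%:E)%E) ->
  0 < p1 -> 0 < p2 -> p1 + p2 = 1 ->
  forall gamma : R, 0 <= gamma < 1 ->
  exists tau : R, 1 / 2 <= tau <= 1 /\
    (exists C, is_Ystar mu f1 f2 p1 p2 gamma tau C) /\
    (forall C, is_Ystar mu f1 f2 p1 p2 gamma tau C ->
       [/\ Rrisk mu f1 f2 p1 p2 gamma = cond_err mu f1 f2 p1 p2 C,
           Rrisk mu f1 f2 p1 p2 gamma =
             fine (Expect mu f1 f2 p1 p2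
                     (fun x u => Num.min (etaf f1 f2 p1 p2 x)
                                         (1 - etaf f1 f2 p1 p2 x)
                                 * (C x u != 0%N)%:R)) / (1 - gamma) &
           forall C0 : T -> nat, (forall x u, 0 <= u <= 1 -> C x u = C0 x) ->
             Rrisk mu f1 f2 p1 p2 gamma =
               fine (\int[mu]_(x in [set x | C0 x != 0%N])
                       (Num.min (p1 * f1 x) (p2 * f2 x))%:E)%E
               / (1 - gamma)]).
Proof.
move=> _ mf1 mf2 f10 f20 if1 if2 _ p10 p20 p12 gamma g01.
have [tau [t01 exC]] := exists_Ystar mu f1 f2 p1 p2 mf1 mf2 f10 f20 if1 if2
  p10 p20 p12 gamma g01.
exists tau; split=> //; split=> // C YC.
have g1 : gamma < 1 by case/andP: g01.
have clC : classifier C by case: YC.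
have resid := Ystar_risk_residual mu f1 f2 p1 p2 mf1 mf2 f10 f20 if1 if2
  p10 p20 p12 gamma tau C t01 g1 YC.
split.
- exact: (Ystar_risk _ _ _ _ _ mf1 mf2 f10 f20 if1 if2 p10 p20 p12 _ tau).
- by rewrite Expect_min_level.
- by move=> C0 CC0; rewrite -(deterministic_residual mu f1 f2 p1 p2 C).
Qed.
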